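(* Let $n \geq 2$ and $m\ge 1$ be integers, let $$P(z) = A_{n}z^{n} + A_{n-1}z^{n-1} + \dots + A_{1}z + A_{0}$$ be a matrix polynomial with $A_{j} \in \mathbb{C}^{m\times m}$ for $j=0,\dots,n$ and $A_{0} \neq 0$, and let $\|\cdot\|$ be any matrix norm on $\mathbb{C}^{m\times m}$ induced by a vector norm on $\mathbb{C}^m$. Let $A_{k}$ be invertible for some $k$ with $1 \leq k \leq n-1$, and let the real polynomial $$f_{k}(x)=\|A_{n}\|x^{n} + \|A_{n-1}\|x^{n-1} + \dots + \|A_{k+1}\|x^{k+1} - \|A^{-1}_{k}\|^{-1}x^{k} + \|A_{k-1}\|x^{k-1} + \dots + \|A_{1}\|x + \|A_{0}\|$$ have two distinct positive roots $x_{1}$ and $x_{2}$ with $x_{1} < x_{2}$. Then $\det(P)$ has exactly $km$ zeros, counted with multiplicity, in the closed disk $|z|\le x_{1}$ and no zeros in the open annulus $x_{1} < |z| < x_{2}$.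
   Context: $\det(P)$ denotes the scalar polynomial $z \mapsto \det(P(z))$. A matrix norm is induced by (subordinate to) a vector norm $\|\cdot\|$ on $\mathbb{C}^m$ if $\|A\| = \max_{\|v\|=1}\|Av\|$. *)

(* Defs.v *)
From mathcomp Require Import all_boot all_order all_algebra.
From mathcomp Require Import complex.
From mathcomp Require Import reals.

Set Implicit Arguments.
Unset Strict Implicit.
Unset Printing Implicit Defensive.

Import Order.TTheory GRing.Theory Num.Theory.
Local Open Scope ring_scope.
Local Open Scope complex_scope.

(* On R[i] the library norm `|z| is R[i]-valued, equal to (sqrt (a^2+b^2))%:C
   at z = a +i* b; real-valued norms are compared with it through %:C. *)
Record vector_norm (R : realType) (m : nat) (N : 'cV[R[i]]_m -> R) : Prop :=
  VectorNorm {
    vnorm_ge0 : forall v, 0 <= N v;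
    vnorm_eq0 : forall v, N v = 0 -> v = 0;
    vnormZ : forall (a : R[i]) v, (N (a *: v))%:C = `|a| * (N v)%:C;
    vnormD : forall u v, N (u + v) <= N u + N v
  }.

(* nu B = max_{N v = 1} N (B v); the maximum is stated as an attained upper
   bound. *)
Definition induced_norm (R : realType) (m : nat) (N : 'cV[R[i]]_m -> R)
    (nu : 'M[R[i]]_m -> R) : Prop :=
  forall B : 'M[R[i]]_m,
    (exists2 v, N v = 1 & nu B = N (B *m v)) /\
    (forall v, N v = 1 -> N (B *m v) <= nu B).

(* The matrix polynomial is a matrix with polynomial entries, so that its
   determinant is a polynomial; see det_matpolyE. *)
Definition matpoly (R : realType) (m n : nat) (A : 'I_n.+1 -> 'M[R[i]]_m) :
    'M[{poly R[i]}]_m :=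
  \sum_(j < n.+1) 'X^j *: map_mx polyC (A j).

Lemma det_matpolyE (R : realType) (m n : nat) (A : 'I_n.+1 -> 'M[R[i]]_m)
    (z : R[i]) :
  (\det (matpoly A)).[z] = \det (\sum_(j < n.+1) z ^+ j *: A j).
Proof.
rewrite -[LHS]/(horner_eval z _) -det_map_mx; congr (\det _).
apply/matrixP => i j; rewrite !mxE summxE summxE raddf_sum /=.
by apply: eq_bigr => l _; rewrite !mxE /horner_eval hornerM hornerXn hornerC.
Qed.

Definition fpoly (R : realType) (m n : nat) (A : 'I_n.+1 -> 'M[R[i]]_m)
    (nu : 'M[R[i]]_m -> R) (k : 'I_n.+1) : {poly R} :=
  \sum_(j < n.+1)
    (if j == k then - (nu (invmx (A k)))^-1 else nu (A j)) *: 'X^j.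

(* Implies that p has only finitely many zeros in D; in particular it fails for
   p = 0 when D is infinite. *)
Definition has_exactly_zeros_in (R : realType) (p : {poly R[i]})
    (D : pred R[i]) (N : nat) : Prop :=
  exists s : seq R[i],
    [/\ uniq s,
        forall z, (z \in s) = root p z && D z
      & (\sum_(z <- s) mup z p)%N = N].

(* Main.v *)
Require Import Defs.
From mathcomp Require Import all_boot all_order all_algebra.
From mathcomp Require Import complex.
From mathcomp Require Import reals.
From mathcomp Require Import ring lra.

Set Implicit Arguments.
Unset Strict Implicit.
Unset Printing Implicit Defensive.

Import Order.TTheory GRing.Theory Num.Theory.
Local Open Scope ring_scope.
Local Open Scope complex_scope.

(* The function f_k(x) / x^k is strictly convex on x > 0, so f_k < 0 on the
   interval (x1, x2).  There the term A_k z^k dominates, hence for 0 <= t <= 1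
   the determinant q_t of A_k z^k + t * (the other terms) has no zero in the
   annulus.  The number of zeros of q_t in the disk is km at t = 0, where
   q_0 = det(A_k) z^(km), and it does not depend on t, by the following
   substitute for Rouche's theorem.  For x1 < r < r' < x2 and W the set of N-th
   roots of unity,
     prod_(w in W) |q_t(r' w)| / prod_(w in W) |q_t(r w)|
       = prod_a |a^N - r'^N| / |a^N - r^N|,
   with a ranging over the zeros of q_t.  For N large a factor is within a factor
   2 of (r'/r)^N if |a| <= x1, and of 1 if |a| >= x2.  So the quotient stays
   close to powers of (r'/r)^N, the exponent being the number of zeros in the
   disk; as its square is a quotient of real polynomials in t, the intermediate
   value theorem forbids a jump. *)

(** * Tangent bounds for powers and the sign of [f_k] between its roots *)

(** Bernoulli's inequality for [u ^+ (j - k)], multiplied by [u ^+ k] so that the case [j < k] can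
    be written without negative exponents. *)
Lemma expr_tangent_ge (F : realFieldType) (u : F) (j k : nat) :
  0 < u -> (k <= j)%N -> u ^+ k * (1 + (j%:R - k%:R) * (u - 1)) <= u ^+ j.
Proof.
move=> u0 kj; rewrite -(subnK kj) addnC exprD ler_pM2l ?exprn_gt0//.
rewrite natrD addrAC subrr add0r; elim: (j - k)%N => [|l IH].
  by rewrite mul0r addr0.
rewrite exprS -natr1; apply: le_trans (ler_wpM2l (ltW u0) IH).
have l0 : 0 <= l%:R :> F by [].
by have := mulr_ge0 l0 (sqr_ge0 (u - 1)); lra.
Qed.

(** With [l = k - j], the quantity [u ^+ l * (1 - l * (u - 1))] equals 1 at [l = 0], and passing to
    [l + 1] lowers it by [u ^+ l * (l + 1) * (u - 1) ^+ 2]. *)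
Lemma expr_tangent_gt (F : realFieldType) (u : F) (j k : nat) :
  0 < u -> u != 1 -> (j < k)%N ->
  u ^+ k * (1 + (j%:R - k%:R) * (u - 1)) < u ^+ j.
Proof.
move=> u0 u1 jk; rewrite -(subnK (ltnW jk)) addnC exprD -mulrA gtr_pMr ?exprn_gt0//.
have : (0 < k - j)%N by rewrite subn_gt0.
rewrite natrD opprD addrA subrr add0r; case: (k - j)%N => // l _.
have d0 : 0 < (u - 1) ^+ 2 by rewrite lt_def sqr_ge0 sqrf_eq0 subr_eq0 u1.
elim: l => [|l IH]; first by rewrite expr1; lra.
apply: lt_trans IH; rewrite -[in ltLHS]natr1 exprSr -mulrA ltr_pM2l ?exprn_gt0//.
have l0 : 0 <= l.+1%:R :> F by [].
by have := mulr_ge0 l0 (ltW d0); lra.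
Qed.

Lemma expr_tangent (F : realFieldType) (u : F) (j k : nat) : 0 < u ->
  u ^+ k * (1 + (j%:R - k%:R) * (u - 1)) <= u ^+ j.
Proof.
move=> u0; case: (leqP k j) => [|jk]; first exact: expr_tangent_ge.
have [->|u1] := eqVneq u 1; first by rewrite subrr mulr0 addr0 !expr1n mulr1.
exact/ltW/expr_tangent_gt.
Qed.

(* [f x / x ^+ k] is strictly convex on the positive axis: it lies above its
   tangents. *)
Lemma pellet_poly_lt0 (F : realFieldType) (n : nat) (b : 'I_n.+1 -> F)
    (k : 'I_n.+1) (x1 x2 x : F) :
  let f y := \sum_(j < n.+1) b j * y ^+ j in
  (0 < k)%N -> (forall j, j != k -> 0 <= b j) -> 0 < b ord0 ->
  0 < x1 -> f x1 = 0 -> f x2 = 0 -> x1 < x < x2 -> f x < 0.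
Proof.
move=> f k0 b0 b00 x10 f1 f2 /andP[x1x xx2].
have x0 : 0 < x by apply: lt_trans x1x.
(* [s] is [x ^+ k.+1] times the derivative of [f y / y ^+ k] at [y = x]. *)
pose s := \sum_(j < n.+1) b j * x ^+ j * (j%:R - k%:R).
have tangent y : 0 < y -> y != x -> f y = 0 -> f x + s * (y / x - 1) < 0.
  move=> y0 yx fy; have u0 : 0 < y / x by rewrite divr_gt0.
  have u1 : y / x != 1.
    by apply: contra yx => /eqP e; rewrite -(divfK (lt0r_neq0 x0) y) e mul1r.
  rewrite -(pmulr_rlt0 _ (exprn_gt0 k u0)) -fy /f /s mulr_suml -big_split/=.
  have ye j : y ^+ j = x ^+ j * (y / x) ^+ j.
    by rewrite -exprMn mulrCA divff ?mulr1 ?gt_eqF.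
  (* The constant term is split off because it supplies the strict inequality: [b ord0 > 0] and
     [0 < k]. *)
  rewrite mulr_sumr [ltRHS](bigD1 ord0) //= [ltLHS](bigD1 ord0) //=.
  apply: ltr_leD.
    rewrite [ltLHS](_ : _ =
      b ord0 * ((y / x) ^+ k * (1 + (0%:R - k%:R) * (y / x - 1)))); last first.
      by rewrite /= expr0; set u := (y / x) ^+ k; ring.
    rewrite ltr_pM2l//; have := expr_tangent_gt u0 u1 k0.
    by rewrite !expr0.
  apply: ler_sum => j _; rewrite ye.
  rewrite [leLHS](_ : _ = b j * (x ^+ j *
    ((y / x) ^+ k * (1 + (j%:R - k%:R) * (y / x - 1))))); last by ring.
  have [->|jk] := eqVneq j k; first by rewrite subrr mul0r addr0 mulr1.
  rewrite ler_wpM2l ?b0// ler_wpM2l ?exprn_ge0 ?(ltW x0)//.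
  exact: expr_tangent.
(* If [f x >= 0], the tangent slope would have to be negative towards [x2] and positive towards
   [x1]. *)
rewrite ltNge; apply/negP => fx0.
have := tangent _ x10 (negbT (lt_eqF x1x)) f1.
have := tangent _ (lt_trans x0 xx2) (negbT (gt_eqF xx2)) f2.
have p1 : x1 / x - 1 < 0 by rewrite subr_lt0 ltr_pdivrMr ?mul1r.
have p2 : 0 < x2 / x - 1 by rewrite subr_gt0 ltr_pdivlMr ?mul1r.
have [s0|s0] := leP 0 s.
  by have := mulr_ge0 s0 (ltW p2); lra.
by have := mulr_le0 (ltW s0) (ltW p1); lra.
Qed.

(** * Zeros of split polynomials and the real-valued modulus *)

Lemma has_exactly_zeros_in_prod (R : realType) (c : R[i]) (rs : seq R[i])
    (D : pred R[i]) : c != 0 ->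
  has_exactly_zeros_in (c *: \prod_(z <- rs) ('X - z%:P)) D (count D rs).
Proof.
move=> c0; exists (undup (filter D rs)); split; first exact: undup_uniq.
  by move=> z; rewrite mem_undup mem_filter rootZ// root_prod_XsubC andbC.
transitivity (\sum_(z <- undup (filter D rs)) count_mem z (filter D rs))%N.
  apply: eq_big_seq => z.
  rewrite mem_undup mem_filter => /andP[Dz _].
  rewrite -mul_polyC mupMr ?rootC// mu_prod_XsubC count_filter.
  apply: eq_count => w /=; case: eqVneq => //= ->.
  by rewrite Dz.
(* The length of the filtered list is a sum of ones, regrouped by distinct value. *)
rewrite -size_filter -[RHS]sum1_size -[RHS]big_undup_iterop_count/=.
apply: eq_bigr => z _. by elim: count => // -[|l] //= ->.
Qed.

Local Notation normc := Normc.normc.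

Lemma normE (R : rcfType) (z : R[i]) : `|z| = (normc z)%:C.
Proof. by case: z. Qed.

Lemma normc_ge0 (R : rcfType) (z : R[i]) : 0 <= normc z.
Proof. by rewrite -ler0c -normE. Qed.

Lemma normcX (R : rcfType) (z : R[i]) n : normc (z ^+ n) = normc z ^+ n.
Proof. by apply: complexI; rewrite -normE normrX normE rmorphXn. Qed.

Lemma normc_real (R : rcfType) (x : R) : 0 <= x -> normc x%:C = x.
Proof. by move=> x0; apply: complexI; rewrite -normE ger0_norm ?ler0c. Qed.

Lemma normc_prod (R : rcfType) (I : Type) (s : seq I) (F : I -> R[i]) :
  normc (\prod_(i <- s) F i) = \prod_(i <- s) normc (F i).
Proof.
apply: complexI; rewrite -normE normr_prod rmorph_prod.
by apply: eq_bigr => i _; rewrite normE.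
Qed.

Lemma normc_distC (R : rcfType) (z w : R[i]) : normc (z - w) = normc (w - z).
Proof. by apply: complexI; rewrite -!normE distrC. Qed.

Lemma normcB_bounds (R : rcfType) (z w : R[i]) :
  normc z - normc w <= normc (z - w) <= normc z + normc w.
Proof.
by rewrite -!lecR rmorphB rmorphD /= -!normE lerB_dist ler_normB.
Qed.

(** * Products over roots of unity *)

Lemma unity_roots (F : closedFieldType) (n : nat) : (0 < n)%N ->
  exists2 s : seq F, size s = n & 'X^n - 1 = \prod_(w <- s) ('X - w%:P).
Proof.
move=> n0; have [s es] := closed_field_poly_normal ('X^n - 1 : {poly F}).
have /eqP lc : lead_coef ('X^n - 1 : {poly F}) == 1 by rewrite lead_coefXnsubC.
exists s; last by rewrite es lc scale1r.
by move/(congr1 (size : {poly F} -> _)): es;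
  rewrite lc scale1r size_XnsubC// size_prod_XsubC => -[].
Qed.

(** Taking [r] out of every factor leaves the value of ['X^n - 1] at [a / r]. *)
Lemma prod_sub_unity (F : fieldType) (n : nat) (s : seq F) (a r : F) :
  r != 0 -> size s = n -> 'X^n - 1 = \prod_(w <- s) ('X - w%:P) ->
  \prod_(w <- s) (a - r * w) = a ^+ n - r ^+ n.
Proof.
move=> r0 sn es.
have -> : \prod_(w <- s) (a - r * w) = r ^+ n * \prod_(w <- s) (a / r - w).
  rewrite -sn -iter_mulr_1 -count_predT -big_const_seq -big_split/=.
  by apply: eq_bigr => w _; rewrite mulrBr mulrCA divff// mulr1.
have -> : \prod_(w <- s) (a / r - w) = ('X^n - 1 : {poly F}).[a / r].
  rewrite es horner_prod; apply: eq_bigr => w _.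
  by rewrite hornerD hornerN hornerX hornerC.
rewrite !hornerE expr_div_n mulrBr mulr1 mulrCA divff ?mulr1//.
by rewrite expf_neq0.
Qed.

(** * Growth of the products between two radii *)

Lemma bernoulli_archi (R : archiRealFieldType) (b M : R) : 1 < b ->
  exists n0, forall n, (n0 <= n)%N -> M <= b ^+ n.
Proof.
move=> b1; pose h := b - 1; have h0 : 0 < h by rewrite subr_gt0.
exists (Num.bound (`|M| / h)) => n ln.
have bern l : 1 + l%:R * h <= b ^+ l.
  have := @expr_tangent_ge _ b l 0 (lt_trans ltr01 b1) isT.
  by rewrite expr0 mul1r subr0.
apply: le_trans (bern n); apply: le_trans (ler_norm _) _.
have : `|M| / h < n%:R.
  apply: lt_le_trans (archi_boundP _) _; last by rewrite ler_nat.
  by rewrite divr_ge0 ?(ltW h0).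
by rewrite ltr_pdivrMr// => /ltW H; apply: le_trans H _; rewrite lerDr.
Qed.

(** Here [s], [r], [r'] stand for the N-th powers of [|a|] and of the two radii, and [y], [y'] for
    the distances from [a ^+ N]. Both [y / r] and [y' / r'] lie in [2/3, 4/3], so their quotient
    lies in [1/2, 2]. *)
Lemma factor_ratio_inside (F : realFieldType) (s r r' y y' : F) :
  0 < r -> r <= r' -> 3 * s <= r -> r - s <= y -> y <= r + s ->
  r' - s <= y' -> y' <= r' + s -> 0 <= s ->
  y' <= 2 * (r' / r) * y /\ (r' / r) * y <= 2 * y'.
Proof.
move=> r0 rr' sr y1 y2 y1' y2' s0.
have r1 : 1 <= r' / r by rewrite ler_pdivlMr// mul1r.
have er : r' = (r' / r) * r by rewrite divfK// lt0r_neq0.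
set l := r' / r in r1 er *; rewrite {}er in rr' y1' y2' *.
have l0 : 0 <= l by apply: le_trans r1.
have h1 := ler_wpM2l l0 y1; have h2 := ler_wpM2l l0 y2.
have h3 := ler_wpM2l l0 sr.
have h4 : s <= l * s by rewrite ler_peMl.
by split; lra.
Qed.

(** Now [s] dominates: both [y] and [y'] lie between [2 * s / 3] and [4 * s / 3]. *)
Lemma factor_ratio_outside (F : realFieldType) (s r r' y y' : F) :
  0 < r -> r <= r' -> 3 * r' <= s -> s - r <= y -> y <= s + r ->
  s - r' <= y' -> y' <= s + r' -> y' <= 2 * y /\ y <= 2 * y'.
Proof. by move=> *; split; lra. Qed.

Lemma within_factor_mul (F : realFieldType) (a b K y y' m m' : F) :
  0 <= a -> 0 <= b -> 0 <= y -> 0 <= y' -> 0 <= m -> 0 <= m' ->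
  y' <= 2 * a * y /\ a * y <= 2 * y' -> m' <= K * b * m /\ b * m <= K * m' ->
  y' * m' <= 2 * K * (a * b) * (y * m) /\ a * b * (y * m) <= 2 * K * (y' * m').
Proof.
move=> a0 b0 y0 y'0 m0 m'0 [k1 k2] [l1 l2]; split.
  rewrite [leRHS](_ : _ = 2 * a * y * (K * b * m)); last by ring.
  exact: ler_pM.
rewrite [leLHS](_ : _ = a * y * (b * m)); last by ring.
rewrite [leRHS](_ : _ = 2 * y' * (K * m')); last by ring.
by apply: ler_pM => //; apply: mulr_ge0.
Qed.

Lemma prod_growth (F : realFieldType) (I : eqType) (D : pred I) (f f' : I -> F)
    (l : F) (s : seq I) : 0 <= l ->
  (forall i, 0 <= f i) -> (forall i, 0 <= f' i) ->
  {in s, forall i, let a := if D i then l else 1 in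
    f' i <= 2 * a * f i /\ a * f i <= 2 * f' i} ->
  \prod_(i <- s) f' i <= 2 ^+ size s * l ^+ count D s * \prod_(i <- s) f i /\
  l ^+ count D s * \prod_(i <- s) f i <= 2 ^+ size s * \prod_(i <- s) f' i.
Proof.
move=> l0 f0 f'0; elim: s => [|i s IH] ins.
  by rewrite /= !expr0 !big_nil !mulr1.
have {}IH := IH (fun j js => ins j (mem_behead (s := i :: s) js)).
have {}ins := ins i (mem_head _ _).
rewrite !big_cons [size _]/= [count _ _]/= exprS.
have -> : l ^+ (D i + count D s) = (if D i then l else 1) * l ^+ count D s.
  by case: (D i); rewrite ?exprS ?mul1r.
apply: (within_factor_mul _ (exprn_ge0 _ l0) (f0 i) (f'0 i) _ _ ins IH).
- by case: ifP.
- by apply: prodr_ge0.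
- by apply: prodr_ge0.
Qed.

(** The triangle inequality reduces this to the two preceding cases; the N-th powers provide the
    separation by a factor 3 that they require. *)
Lemma radial_factor (R : rcfType) (N : nat) (x1 x2 r r' : R) (a : R[i]) :
  0 < r -> r <= r' -> 0 <= x1 -> 0 <= x2 ->
  3 * x1 ^+ N <= r ^+ N -> 3 * r' ^+ N <= x2 ^+ N ->
  `|a| <= x1%:C \/ x2%:C <= `|a| ->
  let l := if `|a| <= x1%:C then (r' / r) ^+ N else 1 in
  normc (a ^+ N - r'%:C ^+ N) <= 2 * l * normc (a ^+ N - r%:C ^+ N) /\
  l * normc (a ^+ N - r%:C ^+ N) <= 2 * normc (a ^+ N - r'%:C ^+ N).
Proof.
move=> r0 rr' x10 x20 x1r r'x2; rewrite normE !lecR => ina.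
have r'0 : 0 < r' by apply: lt_le_trans rr'.
have bounds p : 0 < p -> normc a ^+ N - p ^+ N <= normc (a ^+ N - p%:C ^+ N) /\
    p ^+ N - normc a ^+ N <= normc (a ^+ N - p%:C ^+ N) /\
    normc (a ^+ N - p%:C ^+ N) <= p ^+ N + normc a ^+ N.
  move=> p0; rewrite -[in p ^+ N](normc_real (ltW p0)) -!normcX.
  have /andP[-> _] := normcB_bounds (a ^+ N) (p%:C ^+ N).
  rewrite normc_distC; have /andP[-> h] := normcB_bounds (p%:C ^+ N) (a ^+ N).
  by [].
have [h1 [h2 h3]] := bounds r r0; have [h4 [h5 h6]] := bounds r' r'0.
have a0 : 0 <= normc a ^+ N by rewrite exprn_ge0// normc_ge0.
have rN0 : 0 < r ^+ N by rewrite exprn_gt0.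
have rrN : r ^+ N <= r' ^+ N by apply: lerXn2r => //; rewrite nnegrE ltW.
rewrite expr_div_n; case: ifP ina => [ax _ | _ [//|ax]] /=.
  have aN : normc a ^+ N <= x1 ^+ N by apply: lerXn2r => //; apply: normc_ge0.
  apply: (factor_ratio_inside rN0 rrN _ h2 h3 h5 h6 a0).
  by apply: le_trans x1r; rewrite ler_wpM2l.
have aN : x2 ^+ N <= normc a ^+ N by apply: lerXn2r => //; apply: normc_ge0.
rewrite mulr1 mul1r; apply: (factor_ratio_outside rN0 rrN _ h1 _ h4 _).
- exact: le_trans aN.
- by rewrite [leRHS]addrC.
- by rewrite [leRHS]addrC.
Qed.

(** The squared modulus is the sum of the squares of the real and imaginary parts, hence polynomial
    in a real argument; this opens the way to the intermediate value theorem for polynomials. *)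
Lemma sqr_normc_poly (R : rcfType) (p : {poly R[i]}) :
  exists P : {poly R}, forall t, P.[t] = normc p.[t%:C] ^+ 2.
Proof.
have [[re im] pE] : exists P : {poly R} * {poly R},
    forall t, p.[t%:C] = P.1.[t] +i* P.2.[t].
  elim/poly_ind: p => [|p c [[re im] pE]]; first by exists (0, 0) => t; rewrite !horner0.
  exists (re * 'X + (complex.Re c)%:P, im * 'X + (complex.Im c)%:P) => t.
  by rewrite !hornerE pE; case: c => a b /=; simpc.
exists (re ^+ 2 + im ^+ 2) => t; apply: complexI.
by rewrite rmorphXn /= -normE -add_Re2_Im2 pE !hornerE.
Qed.

(** After exchanging the two products, each root [a] contributes a product over the roots of unity,
    evaluated by [prod_sub_unity]. *)
Lemma normc_horner_unity (R : rcfType) (N : nat) (W rs : seq R[i]) (c : R[i])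
    (rho : R) : 0 < rho -> size W = N ->
  'X^N - 1 = \prod_(w <- W) ('X - w%:P) ->
  normc (\prod_(w <- W) (c *: \prod_(a <- rs) ('X - a%:P)).[rho%:C * w]) =
  normc c ^+ N * \prod_(a <- rs) normc (a ^+ N - rho%:C ^+ N).
Proof.
move=> rho0 sW eW; have rhoC : rho%:C != 0 by rewrite fmorph_eq0 gt_eqF.
transitivity (normc (c ^+ N * \prod_(a <- rs) \prod_(w <- W) (rho%:C * w - a))).
  congr normc; rewrite exchange_big/= -sW -iter_mulr_1 -count_predT -big_const_seq.
  rewrite -big_split/=; apply: eq_bigr => w _.
  rewrite hornerZ horner_prod; congr (_ * _); apply: eq_bigr => a _.
  by rewrite !hornerE.
rewrite Normc.normcM normcX normc_prod; congr (_ * _); apply: eq_bigr => a _.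
rewrite -(prod_sub_unity a rhoC sW eW) !normc_prod; apply: eq_bigr => w _.
exact: normc_distC.
Qed.

(* The threshold [2 * 2 ^+ d * l ^+ e] lies strictly between the ranges of
   [M' / M] for [k <= e] and for [k > e]. *)
Lemma growth_gap (F : realFieldType) (d e n k : nat) (l M M' : F) :
  4 * (2 ^+ d) ^+ 2 <= l -> (n <= d)%N -> 0 < M -> 0 <= M' ->
  M' <= 2 ^+ n * l ^+ k * M /\ l ^+ k * M <= 2 ^+ n * M' ->
  if (k <= e)%N then M' < 2 * 2 ^+ d * l ^+ e * M
  else 2 * 2 ^+ d * l ^+ e * M < M'.
Proof.
move=> Kl nd M0 M'0 [].
have : 2 ^+ n <= 2 ^+ d :> F by rewrite ler_eXn2l// ltr1n.
have K1 : 1 <= 2 ^+ d :> F by rewrite exprn_ege1// ler1n.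
have c0 : 0 <= 2 ^+ n :> F by rewrite exprn_ge0.
move: (2 ^+ d) (2 ^+ n) Kl K1 c0 => K c Kl K1 c0 cK up lo.
have K0 : 0 < K by apply: lt_le_trans K1.
have l1 : 1 <= l by apply: le_trans Kl; nra.
have l0 : 0 < l by apply: lt_le_trans l1.
have le0 : 0 < l ^+ e by rewrite exprn_gt0.
case: leqP => [ke|ek].
  have h : l ^+ k <= l ^+ e by rewrite ler_weXn2l.
  apply: le_lt_trans up _; rewrite ltr_pM2r//.
  apply: le_lt_trans (_ : K * l ^+ e < _).
    by apply: ler_pM => //; rewrite exprn_ge0// ltW.
  by rewrite ltr_pM2r//; lra.
(* After multiplication by [K], the claim follows from [2 * K ^+ 2 * l ^+ e < l ^+ e.+1], which
   [4 * K ^+ 2 <= l] ensures. *)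
rewrite -(ltr_pM2l K0); apply: lt_le_trans (_ : l ^+ k * M <= _); last first.
  by apply: le_trans lo _; rewrite ler_wpM2r.
rewrite mulrA ltr_pM2r//; apply: lt_le_trans (_ : l ^+ e.+1 <= _); last first.
  by rewrite ler_weXn2l.
rewrite exprS mulrA ltr_pM2r//; apply: lt_le_trans Kl.
by have := mulr_gt0 K0 K0; lra.
Qed.

(** The growth of [G] from [r] to [r'] reveals on which side of [e] the number of inner roots lies;
    the leading coefficient enters both values as the same factor and cancels. *)
Lemma growth_count (R : rcfType) (N d e : nat) (x1 x2 r r' : R)
    (W rs : seq R[i]) (c : R[i])
    (G := fun rho : R =>
       normc (\prod_(w <- W) (c *: \prod_(a <- rs) ('X - a%:P)).[rho%:C * w])) :
  0 <= x1 -> x1 < r -> r <= r' -> r < x2 -> (0 < N)%N ->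
  3 * x1 ^+ N <= r ^+ N -> 3 * r' ^+ N <= x2 ^+ N ->
  4 * (2 ^+ d) ^+ 2 <= (r' / r) ^+ N ->
  size W = N -> 'X^N - 1 = \prod_(w <- W) ('X - w%:P) ->
  c != 0 -> (size rs <= d)%N ->
  {in rs, forall a, `|a| <= x1%:C \/ x2%:C <= `|a|} ->
  if (count (fun z => `|z| <= x1%:C)%R rs <= e)%N
  then G r' < 2 * 2 ^+ d * (r' / r) ^+ N ^+ e * G r
  else 2 * 2 ^+ d * (r' / r) ^+ N ^+ e * G r < G r'.
Proof.
move=> x10 x1r rr' rx2 N0 x1rN r'x2N lamN sW eW c0 srs ina.
have r0 : 0 < r by apply: le_lt_trans x1r.
have r'0 : 0 < r' by apply: lt_le_trans rr'.
have x20 : 0 <= x2 by apply/ltW/(lt_trans r0).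
rewrite /G (normc_horner_unity _ _ r0 sW eW) (normc_horner_unity _ _ r'0 sW eW).
(* A root of modulus [r] would lie in the open annulus. *)
have M0 : 0 < \prod_(a <- rs) normc (a ^+ N - r%:C ^+ N).
  rewrite big_seq; apply: prodr_gt0 => a /ina ars.
  rewrite lt_def normc_ge0 andbT; apply/eqP => /Normc.eq0_normc /eqP.
  rewrite subr_eq0 => /eqP /(congr1 (@normc R)).
  rewrite !normcX (normc_real (ltW r0)) => /eqP.
  rewrite eqrXn2 ?normc_ge0 ?(ltW r0)// => /eqP ar.
  by move: ars; rewrite normE !lecR ar leNgt x1r leNgt rx2 => -[].
have M'0 : 0 <= \prod_(a <- rs) normc (a ^+ N - r'%:C ^+ N).
  by apply: prodr_ge0 => a _; apply: normc_ge0.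
have lam0 : 0 <= (r' / r) ^+ N by rewrite exprn_ge0// divr_ge0 ?(ltW r0) ?(ltW r'0).
have := prod_growth lam0 (fun a => normc_ge0 (a ^+ N - r%:C ^+ N))
  (fun a => normc_ge0 (a ^+ N - r'%:C ^+ N))
  (fun a ars => radial_factor r0 rr' x10 x20 x1rN r'x2N (ina a ars)).
move/(growth_gap e lamN srs M0 M'0).
have cN0 : 0 < normc c ^+ N.
  rewrite exprn_gt0// lt_def normc_ge0 andbT; apply: contra c0 => /eqP h.
  exact/eqP/(Normc.eq0_normc h).
by case: ifP => _ gap; rewrite [_ * (normc c ^+ N * _)]mulrCA ltr_pM2l.
Qed.

(** * Invariance of the zero count along a homotopy *)

Lemma count_homotopy (R : realType) (q : {poly {poly R[i]}}) (x1 x2 : R)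
    (qt := fun t : R => map_poly (horner_eval t%:C) q)
    (D := fun z : R[i] => `|z| <= x1%:C) (rs0 rs1 : seq R[i]) (c0 c1 : R[i]) :
  0 < x1 -> x1 < x2 ->
  (forall t z, 0 <= t <= 1 -> x1%:C < `|z| < x2%:C -> ~~ root (qt t) z) ->
  c0 != 0 -> qt 0 = c0 *: \prod_(a <- rs0) ('X - a%:P) ->
  c1 != 0 -> qt 1 = c1 *: \prod_(a <- rs1) ('X - a%:P) ->
  count D rs0 = count D rs1.
Proof.
move=> x10 x12 noroot c00 q0E c10 q1E.
pose r := (2 * x1 + x2) / 3; pose r' := (x1 + 2 * x2) / 3.
have x1r : x1 < r by rewrite /r; lra.
have rr' : r < r' by rewrite /r /r'; lra.
have r'x2 : r' < x2 by rewrite /r'; lra.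
have r0 : 0 < r by apply: lt_trans x1r.
have r'0 : 0 < r' by apply: lt_trans rr'.
(* This bounds the number of zeros of [qt t] uniformly in [t], so a single [N] serves the whole
   homotopy. *)
pose d := size q.
have big_ratio (a b M : R) : 0 < a -> a < b ->
    exists n0, forall n, (n0 <= n)%N -> M * a ^+ n <= b ^+ n.
  move=> a0 ab; have [|n0 n0P] := @bernoulli_archi R (b / a) M.
    by rewrite ltr_pdivlMr// mul1r.
  by exists n0 => n /n0P; rewrite expr_div_n ler_pdivlMr ?exprn_gt0.
have [n1 n1P] := big_ratio _ _ 3 x10 x1r.
have [n2 n2P] := big_ratio _ _ 3 r'0 r'x2.
have [n3 n3P] := big_ratio _ _ (4 * (2 ^+ d) ^+ 2) r0 rr'.
pose N := (n1 + n2 + n3).+1.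
have [W sW eW] := @unity_roots R[i] N isT.
pose lam := (r' / r) ^+ N.
have step e t rs c : 0 <= t <= 1 -> c != 0 ->
    qt t = c *: \prod_(a <- rs) ('X - a%:P) ->
    if (count D rs <= e)%N
    then normc (\prod_(w <- W) (qt t).[r'%:C * w]) <
         2 * 2 ^+ d * lam ^+ e * normc (\prod_(w <- W) (qt t).[r%:C * w])
    else 2 * 2 ^+ d * lam ^+ e * normc (\prod_(w <- W) (qt t).[r%:C * w]) <
         normc (\prod_(w <- W) (qt t).[r'%:C * w]).
  move=> t01 cn0 qE; rewrite qE; apply: growth_count (cn0) _ _ => //.
  - exact: ltW x10.
  - exact: ltW.
  - exact: lt_trans r'x2.
  - by apply/n1P/leqW; rewrite -addnA leq_addr.
  - by apply/n2P/leqW; rewrite addnAC leq_addl.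
  - rewrite expr_div_n ler_pdivlMr ?exprn_gt0//.
    by apply/n3P/leqW; rewrite leq_addl.
  - have : (size (qt t) <= d)%N by apply: size_poly.
    by rewrite qE (size_scale _ cn0) size_prod_XsubC => /ltnW.
  - move=> a ars; have := noroot t a t01.
    rewrite qE rootZ// root_prod_XsubC ars normE !ltcR !lecR => h.
    case: (leP (normc a) x1) => [|ax]; first by left.
    by right; rewrite leNgt; apply/negP => xa; move: h; rewrite ax xa => /(_ isT).
have polyG rho : exists P : {poly R},
    forall t, P.[t] = normc (\prod_(w <- W) (qt t).[rho%:C * w]) ^+ 2.
  (* Substituting a constant for the outer variable of [q] leaves a polynomial in the homotopy
     parameter. *)
  have [P PE] := sqr_normc_poly (\prod_(w <- W) q.[(rho%:C * w)%:P]).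
  exists P => t; rewrite PE horner_prod; congr (normc _ ^+ 2).
  apply: eq_bigr => w _; rewrite /qt -!horner_evalE.
  by rewrite -[in RHS](hornerC (rho%:C * w) t%:C) [RHS](horner_map (horner_eval t%:C)).
have [U UE] := polyG r; have [V VE] := polyG r'.
(* Two natural numbers with the same upper bounds are equal, so each threshold [e] can be treated
   separately. *)
suff eqv e : (count D rs0 <= e)%N = (count D rs1 <= e)%N.
  by apply/eqP; rewrite eqn_leq eqv leqnn -eqv leqnn.
pose T := 2 * 2 ^+ d * lam ^+ e.
have lam0 : 0 <= lam by rewrite /lam exprn_ge0// divr_ge0// ltW.
have T0 : 0 <= T.
  exact: mulr_ge0 (mulr_ge0 (ler0n _ 2) (exprn_ge0 d (ler0n _ 2)))
    (exprn_ge0 e lam0).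
(* The sign of [h] at [t] tells whether [qt t] has at most [e] zeros in the disk. *)
pose h : {poly R} := V - T ^+ 2 *: U.
have sgn t rs c : 0 <= t <= 1 -> c != 0 ->
    qt t = c *: \prod_(a <- rs) ('X - a%:P) ->
    if (count D rs <= e)%N then h.[t] < 0 else 0 < h.[t].
  move=> t01 cn0 qE; have := step e t rs c t01 cn0 qE; rewrite -/T.
  rewrite /h hornerD hornerN hornerZ UE VE -exprMn.
  have TG0 z : 0 <= T * normc z by apply: mulr_ge0 T0 (normc_ge0 z).
  case: ifP => _ lt; rewrite ?subr_lt0 ?subr_gt0.
    by rewrite ltr_pXn2r ?nnegrE ?normc_ge0 ?TG0.
  by rewrite ltr_pXn2r ?nnegrE ?normc_ge0 ?TG0.
have noz t : 0 <= t <= 1 -> h.[t] != 0.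
  move=> t01; have [rs qE] := closed_field_poly_normal (qt t).
  have lc0 : lead_coef (qt t) != 0.
    (* The zero polynomial would have the root [r] in the annulus. *)
    rewrite lead_coef_eq0; apply/eqP => qt0.
    have := noroot t r%:C t01; rewrite qt0 root0 normE normc_real ?ltW// !ltcR.
    by rewrite x1r (lt_trans rr')// => /(_ isT).
  have := sgn t rs _ t01 lc0 qE; case: ifP => _ hs; first by rewrite lt_eqF.
  by rewrite gt_eqF.
(* If the answers at 0 and 1 differed, [h] would change sign and vanish in between, against
   [noz]. *)
have := sgn 0 rs0 c0 _ c00 q0E; have := sgn 1 rs1 c1 _ c10 q1E.
rewrite !lexx ler01 => /(_ isT) + /(_ isT).
case: ifP => _; case: ifP => _ // h1 h0.
  have [|t t01 ht] := @poly_ivt R (- h) 0 1 ler01.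
    by rewrite !hornerN oppr_le0 oppr_ge0 !ltW.
  by have := noz t t01; rewrite -oppr_eq0 -hornerN -rootE ht.
have [|t t01 ht] := @poly_ivt R h 0 1 ler01; first by rewrite !ltW.
by have := noz t t01; rewrite -rootE ht.
Qed.

(** * Induced norms and the dominant term *)

Section InducedNorm.
Variables (R : realType) (m : nat) (N : 'cV[R[i]]_m -> R) (nu : 'M[R[i]]_m -> R).
Hypotheses (hN : vector_norm N) (hnu : induced_norm N nu).

Lemma vector_normZ (a : R[i]) v : N (a *: v) = normc a * N v.
Proof. by apply: complexI; rewrite (vnormZ hN) normE rmorphM. Qed.

Lemma vector_norm0 : N 0 = 0.
Proof. by rewrite -(scale0r 0) vector_normZ Normc.normc0 mul0r. Qed.

Lemma vector_norm_gt0 v : v != 0 -> 0 < N v.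
Proof.
move=> v0; rewrite lt_def (vnorm_ge0 hN) andbT.
by apply: contra v0 => /eqP/(vnorm_eq0 hN)/eqP.
Qed.

Lemma vector_norm_sum (I : Type) (s : seq I) (P : pred I) (F : I -> 'cV[R[i]]_m) :
  N (\sum_(i <- s | P i) F i) <= \sum_(i <- s | P i) N (F i).
Proof.
elim/big_ind2: _ => [|x y u v xy uv|//]; first by rewrite vector_norm0.
by apply: le_trans (vnormD hN _ _) (lerD xy uv).
Qed.

Lemma induced_norm_ge0 B : 0 <= nu B.
Proof. by have [[v _ ->] _] := hnu B; apply: (vnorm_ge0 hN). Qed.

Lemma induced_norm_mul B v : N (B *m v) <= nu B * N v.
Proof.
have [->|v0] := eqVneq v 0; first by rewrite mulmx0 vector_norm0 mulr0.
have Nv0 := vector_norm_gt0 v0.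
have Nv1 : normc (N v)^-1%:C = (N v)^-1.
  by rewrite normc_real// invr_ge0 ltW.
have [_ /(_ ((N v)^-1%:C *: v))] := hnu B.
rewrite -scalemxAr !vector_normZ Nv1 mulVf ?gt_eqF// => /(_ erefl).
by rewrite ler_pdivrMl// mulrC.
Qed.

Lemma induced_norm_gt0 B : B != 0 -> 0 < nu B.
Proof.
move=> B0; rewrite lt_def induced_norm_ge0 andbT; apply: contra B0 => /eqP nB0.
have Bv (v : 'cV_m) : B *m v = 0.
  apply: (vnorm_eq0 hN); apply: le_anti; rewrite (vnorm_ge0 hN) andbT.
  by have := induced_norm_mul B v; rewrite nB0 mul0r.
by apply/eqP/trmx_inj/row_matrixP => i; rewrite -tr_col colE Bv !linear0.
Qed.

(** For a kernel vector [v], the term of index [k] would balance all the others; comparing norms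
    gives [0 <= f_k(|z|) * N v], a contradiction. The family [B] leaves room for the homotopy, which
    shrinks every coefficient but [A k]. *)
Lemma det_dominant_neq0 (n : nat) (A B : 'I_n.+1 -> 'M[R[i]]_m) (k : 'I_n.+1)
    (z : R[i]) : A k \in unitmx -> B k = A k ->
  (forall j v, j != k -> N (B j *m v) <= nu (A j) * N v) ->
  (fpoly A nu k).[normc z] < 0 ->
  \det (\sum_(j < n.+1) z ^+ j *: B j) != 0.
Proof.
(* [det0P] yields a row vector, hence the transposition. *)
move=> Ak Bk BA f0; rewrite -det_tr; apply/negP => /det0P [u u0 uB].
pose v := u^T; have v0 : v != 0 by rewrite trmx_eq0.
have Nv0 := vector_norm_gt0 v0.
have {uB} : (\sum_(j < n.+1) z ^+ j *: B j) *m v = 0.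
  by apply: trmx_inj; rewrite trmx_mul trmxK uB trmx0.
rewrite mulmx_suml (bigD1 k) //= Bk => /(canRL (addrK _)); rewrite sub0r.
move=> /(congr1 N); rewrite -scaleN1r -scalemxAl !vector_normZ.
rewrite normcX (_ : normc (-1) = 1); last first.
  by apply: complexI; rewrite -normE normrN1.
rewrite mul1r => e; set rho := normc z in f0 e.
have rho0 : 0 <= rho by apply: normc_ge0.
have Akv : (nu (invmx (A k)))^-1 * N v <= N (A k *m v).
  have := induced_norm_mul (invmx (A k)) (A k *m v); rewrite mulKmx// => h.
  (* A nonpositive norm of the inverse would force [N v <= 0]. *)
  have [k0|k0] := leP (nu (invmx (A k))) 0; last by rewrite ler_pdivrMl.
  move: h; rewrite leNgt; case/negP; apply: le_lt_trans Nv0.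
  by rewrite mulr_le0_ge0// (vnorm_ge0 hN).
suff : 0 <= (fpoly A nu k).[rho] * N v by rewrite pmulr_lge0// leNgt f0.
rewrite /fpoly horner_sum (bigD1 k) //= eqxx mulrDl hornerZ hornerXn.
rewrite !mulNr addrC subr_ge0 [_^-1 * _]mulrC -mulrA.
apply: le_trans (ler_wpM2l (exprn_ge0 _ rho0) Akv) _; rewrite e.
apply: le_trans (vector_norm_sum _ _ _) _; rewrite mulr_suml.
apply: ler_sum => j jk; rewrite (negbTE jk) hornerZ hornerXn -scalemxAl.
rewrite vector_normZ normcX [nu _ * _]mulrC -mulrA ler_wpM2l ?exprn_ge0//.
exact: BA.
Qed.

End InducedNorm.

(** * The determinant along the homotopy and the zero count *)

Lemma horner_fpoly (R : realType) (m n : nat) (A : 'I_n.+1 -> 'M[R[i]]_m)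
    (nu : 'M[R[i]]_m -> R) (k : 'I_n.+1) (x : R) :
  (fpoly A nu k).[x] = \sum_(j < n.+1)
    (if j == k then - (nu (invmx (A k)))^-1 else nu (A j)) * x ^+ j.
Proof.
by rewrite /fpoly horner_sum; apply: eq_bigr => j _; rewrite hornerZ hornerXn.
Qed.

(* The outer variable of [q] is [z], the inner one is the homotopy parameter. *)
Lemma det_matpoly_homotopy (R : realType) (m n : nat)
    (A : 'I_n.+1 -> 'M[R[i]]_m) (k : 'I_n.+1) :
  exists q : {poly {poly R[i]}}, forall t : R[i],
    map_poly (horner_eval t) q =
    \det (matpoly (fun j => (if j == k then 1 else t) *: A j)).
Proof.
exists (\det (\sum_(j < n.+1) 'X^j *: map_mx polyC
  ((if j == k then 1 else 'X) *: map_mx polyC (A j)))) => t.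
rewrite -det_map_mx; congr (\det _); apply/matrixP => a b.
rewrite !mxE !summxE raddf_sum; apply: eq_bigr => j _.
rewrite !mxE [LHS]rmorphM /= map_polyXn map_polyC /= horner_evalE.
by rewrite hornerM hornerC; case: ifP => _; rewrite ?hornerX ?hornerC.
Qed.

Theorem theorem3p3 (R : realType) (n m : nat) (hn : (2 <= n)%N)
    (hm : (1 <= m)%N) (A : 'I_n.+1 -> 'M[R[i]]_m) (hA0 : A ord0 != 0)
    (N : 'cV[R[i]]_m -> R) (hN : vector_norm N)
    (nu : 'M[R[i]]_m -> R) (hnu : induced_norm N nu)
    (k : 'I_n.+1) (hk : (1 <= k <= n - 1)%N) (hAk : A k \in unitmx)
    (x1 x2 : R) (hx1 : 0 < x1) (hx12 : x1 < x2)
    (hroot1 : root (fpoly A nu k) x1) (hroot2 : root (fpoly A nu k) x2) :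
  has_exactly_zeros_in (\det (matpoly A)) (fun z => `|z| <= x1%:C) (k * m) /\
  (forall z : R[i], x1%:C < `|z| < x2%:C -> ~~ root (\det (matpoly A)) z).
Proof.
have [k0 _] := andP hk.
have f_lt0 x : x1 < x < x2 -> (fpoly A nu k).[x] < 0.
  rewrite horner_fpoly; apply: (@pellet_poly_lt0 _ _ _ k x1 x2) => //.
  - by move=> j /negbTE ->; apply: induced_norm_ge0 hN hnu _.
  - by rewrite (_ : ord0 == k = false) ?(induced_norm_gt0 hN hnu)// -val_eqE /= ltn_eqF.
  - by rewrite -horner_fpoly; apply/rootP.
  - by rewrite -horner_fpoly; apply/rootP.
(* All coefficients except [A k] are scaled by [t]. *)
pose At t j := (if j == k then 1 else t%:C) *: A j.
have noroot t z : 0 <= t <= 1 -> x1%:C < `|z| < x2%:C ->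
    ~~ root (\det (matpoly (At t))) z.
  move=> /andP[t0 t1]; rewrite normE !ltcR => /f_lt0 fz.
  rewrite rootE det_matpolyE; apply: (det_dominant_neq0 hN hnu hAk _ _ fz).
    by rewrite /At eqxx scale1r.
  move=> j v jk; rewrite /At (negbTE jk) -scalemxAl (vector_normZ hN) normc_real//.
  apply: le_trans (induced_norm_mul hN hnu _ _).
  by rewrite ler_piMl// (vnorm_ge0 hN).
have At1 : \det (matpoly (At 1)) = \det (matpoly A).
  congr (\det _); apply: eq_bigr => j _.
  by rewrite /At; case: ifP => _; rewrite scale1r.
have At0 : \det (matpoly (At 0)) =
    \det (A k) *: \prod_(a <- nseq (k * m) 0) ('X - a%:P).
  (* Only the term of index [k] survives at [t = 0], and ['X^k] comes out of the determinant to the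
     power [m]. *)
  rewrite big_nseq subr0 iter_mulr_1 /matpoly (bigD1 k) //= big1 => [|j jk].
    rewrite addr0 detZ /At eqxx scale1r det_map_mx -exprM.
    by rewrite -mul_polyC mulrC.
  by rewrite /At (negbTE jk) scale0r map_mx0 scaler0.
split; last first.
  by move=> z; rewrite -At1; apply: noroot; rewrite ler01 lexx.
have [q qE] := det_matpoly_homotopy A k.
have [rs rsE] := closed_field_poly_normal (\det (matpoly A)).
have lc0 : lead_coef (\det (matpoly A)) != 0.
  (* A zero determinant would vanish at the midpoint of [x1] and [x2]. *)
  rewrite lead_coef_eq0; apply/eqP => d0.
  have mid : x1 < (x1 + x2) / 2 < x2 by apply/andP; split; lra.
  have := noroot 1 ((x1 + x2) / 2)%:C; rewrite At1 d0 root0 ler01 lexx.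
  by rewrite normE normc_real ?ltcR ?mid => [/(_ isT isT)|]; lra.
pose D (z : R[i]) := `|z| <= x1%:C.
have cnt : count D (nseq (k * m) 0) = count D rs.
  have q0E : map_poly (horner_eval 0%:C) q = _ := etrans (qE _) At0.
  have q1E : map_poly (horner_eval 1%:C) q = _ := etrans (qE _) (etrans At1 rsE).
  apply: (count_homotopy hx1 hx12 _ _ q0E lc0 q1E).
    by move=> t z; rewrite qE; apply: noroot.
  by rewrite -unitfE -unitmxE.
have <- : count D rs = (k * m)%N.
  by rewrite -cnt count_nseq /D normr0 ler0c ltW// mul1n.
by rewrite rsE; apply: has_exactly_zeros_in_prod.
Qed.
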